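(* Let $A$ be a simple algebra over a field $F$ with $\mathrm{char}(F)\neq 2$. If the second cohomology group $H^2(A,F)$ is trivial, i.e., every 2-cocycle $\Phi:A\times A\to F$ is a coboundary, then $A$ is zero Lie product determined.
   Context: Algebras are associative and not necessarily unital. For $x,y\in A$, $[x,y]=xy-yx$. A skew-symmetric bilinear functional $\Phi:A\times A\to F$ (that is, $\Phi(x,y)=-\Phi(y,x)$ for all $x,y$) is called a 2-cocycle if $\Phi([x,y],z)+\Phi([z,x],y)+\Phi([y,z],x)=0$ for all $x,y,z\in A$, and a coboundary if there exists $\tau$ in the dual space $A^*$ such that $\Phi(x,y)=\tau([x,y])$ for all $x,y\in A$. Triviality of $H^2(A,F)$ means that every 2-cocycle is a coboundary. An $F$-algebra $A$ is zero Lie product determined (zLpd) if, for every vector space $X$ over $F$ and every bilinear map $\Phi:A\times A\to X$ such that $\Phi(x,y)=0$ whenever $[x,y]=0$, there exists a linear map $\tau:A\to X$ such that $\Phi(x,y)=\tau([x,y])$ for all $x,y\in A$. *)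

(* Defs.v *)
From mathcomp Require Import all_boot all_order all_algebra.

Set Implicit Arguments.
Unset Strict Implicit.
Unset Printing Implicit Defensive.

Import GRing.Theory.
Local Open Scope ring_scope.

(* The ring structures of MathComp are all unital.  A not necessarily unital
   associative F-algebra is therefore given here as a vector space A over F
   (of arbitrary dimension) together with a bilinear product
   mul : {bilinear A -> A -> A} satisfying [associative mul]. *)

Section NonUnitalAlgebra.
Variables (F : fieldType) (A : lmodType F) (mul : {bilinear A -> A -> A}).

Definition commutator (x y : A) : A := mul x y - mul y x.

(* Prop-valued, so that the subspaces considered need not be decidable. *)
Definition two_sided_ideal (I : A -> Prop) : Prop :=
  [/\ I 0,
      forall x y, I x -> I y -> I (x + y),
      forall (c : F) x, I x -> I (c *: x),
      forall a x, I x -> I (mul a x)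
    & forall a x, I x -> I (mul x a)].

(* The condition A A <> 0 is part of simplicity; it implies A <> 0 and excludes
   the one-dimensional algebra with zero product. *)
Definition simple_algebra : Prop :=
  (exists x y, mul x y != 0) /\
  (forall I : A -> Prop, two_sided_ideal I ->
     (forall x, I x -> x = 0) \/ (forall x, I x)).

Definition skew_symmetric (Phi : {biscalar A}) : Prop :=
  forall x y, Phi x y = - Phi y x.

Definition cocycle2 (Phi : {biscalar A}) : Prop :=
  skew_symmetric Phi /\
  forall x y z, Phi (commutator x y) z + Phi (commutator z x) y
                + Phi (commutator y z) x = 0.

Definition coboundary2 (Phi : {biscalar A}) : Prop :=
  exists tau : {scalar A}, forall x y, Phi x y = tau (commutator x y).

Definition trivial_H2 : Prop :=
  forall Phi : {biscalar A}, cocycle2 Phi -> coboundary2 Phi.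

Definition zLpd : Prop :=
  forall (X : lmodType F) (Phi : {bilinear A -> A -> X}),
    (forall x y, commutator x y = 0 -> Phi x y = 0) ->
    exists tau : {linear A -> X}, forall x y, Phi x y = tau (commutator x y).

End NonUnitalAlgebra.

(* Main.v *)
(* Scalar functionals reduce everything to a form Phi with values in F, and it
   suffices that such a Phi is a 2-cocycle.  Polarizing Phi(x^2, x) = 0 shows
   that psi(x, y, z) = Phi(xy, z) + Phi(yz, x) + Phi(zx, y) is alternating; being
   a cyclic coboundary, it is also a Hochschild cocycle.  These two properties
   give psi([x, y], z, w) = - psi([z, w], x, y), so K = {u | psi(u, -, -) = 0} is a
   Lie ideal, and the Jacobi identity puts [[A, A], [A, A]] into K.  If A is not
   commutative, Herstein's theory of Lie ideals gives [A, A] <= K.  The cocycle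
   identity then puts the ideal generated by [[A, A], A] into K, and so psi = 0.
   Finally, psi(x, y, z) - psi(y, x, z) is the cocycle expression of Phi. *)

Require Import Defs.
From HB Require Import structures.
From mathcomp Require Import all_boot all_order all_algebra ring.
From mathcomp Require Import boolp classical_sets.
Import GRing.Theory.
Local Open Scope classical_set_scope.
Local Open Scope ring_scope.

(** * Extension of partially defined linear maps *)

Section LinearExtension.
Variables (F : fieldType) (V W : lmodType F).
Implicit Types G : set (V * W).

Definition linear_relation G : Prop :=
  G (0, 0) /\ forall (c : F) p q, G p -> G q -> G (c *: p + q).

(** The graph of a linear map on a subspace of [V]: by linearity, single-valuedness need only be
    tested at 0. *)
Definition linear_graph G : Prop :=
  linear_relation G /\ forall w, G (0, w) -> w = 0.

Lemma linear_graph_fun {G v w w'} :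
  linear_graph G -> G (v, w) -> G (v, w') -> w = w'.
Proof.
move=> [[G0 Glin] Gfun] Gw Gw'.
have := Glin (-1) _ _ Gw' Gw; rewrite scaleN1r => Gd.
by apply: subr0_eq; apply: Gfun; rewrite -(subrr v) [w - _]addrC [v - v]addrC.
Qed.

Lemma linear_graph_adjoin G a :
  linear_graph G -> (forall w, ~ G (a, w)) ->
  linear_graph [set p | exists2 h, G h & exists c : F, p = h + c *: (a, 0)].
Proof.
move=> [[G0 Glin] Gfun] Ga; split; first split.
- by exists (0, 0) => //; exists 0; rewrite scale0r addr0.
- move=> c _ _ [h Gh [d ->]] [k Gk [e ->]].
  exists (c *: h + k); first exact: Glin.
  by exists (c * d + e); rewrite scalerDl -scalerA scalerDr addrACA.
move=> w [[v u] Gvu [c [/esym vE wE]]]; move: wE; rewrite /= scaler0 addr0 => ->.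
have [c0|c0] := eqVneq c 0.
  by move: vE; rewrite c0 scale0r addr0 => v0; apply: Gfun; rewrite -v0.
(* Here v = -ca with c nonzero, so scaling (v, u) by -1/c would put [a] in the domain of [G]. *)
case: (Ga (- c^-1 *: u)).
have := Glin (- c^-1) _ _ Gvu G0; rewrite addr0.
suff -> : - c^-1 *: (v, u) = (a, - c^-1 *: u) :> V * W by [].
congr pair; have -> : v = - (c *: a) by apply/eqP; rewrite -addr_eq0 vE.
by rewrite /= scalerN scaleNr opprK scalerA mulVf // scale1r.
Qed.

Lemma linear_graph_total G : linear_graph G ->
  exists f : {linear V -> W}, forall v w, G (v, w) -> w = f v.
Proof.
(* Taking unions with [G] makes the empty chain, whose union is empty, satisfy [P]. *)
move=> gG; pose P := [set H | linear_graph (G `|` H)].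
have [B sB totB|H [gH Hmax]] := @Zorn_bigcup (V * W) P.
  have [->|/set0P [C BC]] := eqVneq B set0.
    by rewrite /P /= bigcup_set0 setU0.
  have common p q : (G `|` \bigcup_(X in B) X) p ->
      (G `|` \bigcup_(X in B) X) q ->
      exists2 D, B D & (G `|` D) p /\ (G `|` D) q.
    move=> [Gp|[D BD Dp]] [Gq|[E BE Eq]].
    - by exists C => //; split; left.
    - by exists E => //; split; [left|right].
    - by exists D => //; split; [right|left].
    - have [DE|ED] := totB _ _ BD BE.
        by exists E => //; split; right => //; apply: DE.
      by exists D => //; split; right => //; apply: ED.
  split; first split.
  - by left; case: gG => -[].
  - move=> c p q /common /[apply] -[D BD [Dp Dq]].
    have [[_ lD] _] := sB _ BD.
    by have [Gr|Dr] := lD c _ _ Dp Dq; [left|right; exists D].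
  - move=> w Gw; have [D BD [Dw _]] := common _ _ Gw Gw.
    by have [_] := sB _ BD; apply.
pose K := G `|` H; have gK : linear_graph K by [].
have totK v : exists w, K (v, w).
  apply: contrapT => /forallNP Kv.
  have [[K0 lK] _] := gH.
  pose K' := [set p | exists2 h, K h & exists c : F, p = h + c *: (v, 0)].
  have KK' : K `<=` K'.
    by move=> h Kh; exists h => //; exists 0; rewrite scale0r addr0.
  apply: (Hmax K').
    split.
      by move=> h Hh; apply: KK'; right.
    move=> K'H; apply: (Kv 0); right; apply: K'H; exists (0, 0) => //; exists 1.
    by rewrite scale1r add0r.
  rewrite /P /= setUidr; first exact: linear_graph_adjoin.
  by move=> h Gh; apply: KK'; left.
have [f fK] := choice totK.
have f_lin : linear f.
  move=> c x y; apply: (linear_graph_fun gK (fK (c *: x + y))).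
  by have [[_ lK] _] := gK; apply: lK c _ _ (fK x) (fK y).
pose fM := GRing.isLinear.Build F V W *:%R f f_lin.
pose fL : {linear V -> W} := HB.pack f fM.
exists fL => v w Gvw.
by apply: (linear_graph_fun gK _ (fK v)); left.
Qed.

End LinearExtension.

(** If v is nonzero, cv -> c on its line extends to a functional with value 1 at v. *)
Lemma scalar_separation {F : fieldType} {V : lmodType F} {v : V} :
  (forall f : {scalar V}, f v = 0) -> v = 0.
Proof.
move=> v0; apply: contrapT => /eqP vN0.
pose G := [set p : V * F^o | exists c : F, p = (c *: v, c)].
have [|f fG] := @linear_graph_total F V F^o G.
  split; first split.
  - by exists 0; rewrite scale0r.
  - move=> c _ _ [d ->] [e ->]; exists (c * d + e).
    by rewrite scalerDl -scalerA.
  - by move=> w [c [/esym/eqP]]; rewrite scaler_eq0 (negPf vN0) orbF => /eqP-> ->.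
have := v0 f; rewrite -(fG v 1); last by exists 1; rewrite scale1r.
by move/eqP; rewrite oner_eq0.
Qed.

Lemma scalar_ext {F : fieldType} {V : lmodType F} (u v : V) :
  (forall f : {scalar V}, f u = f v) -> u = v.
Proof.
by move=> uv; apply/subr0_eq/scalar_separation => f; rewrite linearB uv subrr.
Qed.

(** * Commutators and annihilators in a simple algebra *)

Section SimpleAlgebra.
Variables (F : fieldType) (A : lmodType F) (mul : {bilinear A -> A -> A}).
Hypotheses (mulA : associative mul) (charF : 2%N \notin [pchar F]).
Hypothesis simpleA : simple_algebra mul.

Local Notation "x · y" := (mul x y) (at level 40, left associativity).
Local Notation "⟦ x , y ⟧" := (commutator mul x y).

(* MathComp has no decision procedure for noncommutative rings, so an identity
   in A is checked through the scalar functionals. *)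
Ltac algebra_identity :=
  apply: scalar_ext => f;
  rewrite /commutator ?(linearDl, linearDr, linearBl, linearBr, linearNl,
    linearNr, linearZl_LR, linearZr_LR, mulA) /=;
  rewrite ?(linearD, linearB, linearN, linearZ) /=; ring.

Lemma addvv_eq0 (V : lmodType F) (v : V) : v + v = 0 -> v = 0.
Proof.
move=> /eqP; rewrite -mulr2n -scaler_nat scaler_eq0 => /orP[/eqP n2|/eqP//].
by case/negP: charF; rewrite inE /= n2 eqxx.
Qed.

Lemma commDl x y z : ⟦x + y, z⟧ = ⟦x, z⟧ + ⟦y, z⟧.
Proof. algebra_identity. Qed.

Lemma commZl c x y : ⟦c *: x, y⟧ = c *: ⟦x, y⟧.
Proof. algebra_identity. Qed.

Lemma comm0l x : ⟦0, x⟧ = 0.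
Proof. by rewrite /commutator linear0l linear0r subr0. Qed.

Lemma comm_antisym x y : ⟦x, y⟧ = - ⟦y, x⟧.
Proof. by rewrite /commutator opprB. Qed.

Lemma comm_jacobi x y z : ⟦x, ⟦y, z⟧⟧ = ⟦⟦x, y⟧, z⟧ - ⟦⟦x, z⟧, y⟧.
Proof. algebra_identity. Qed.

Lemma comm_mull x y z : ⟦x · y, z⟧ = ⟦x, y · z⟧ + ⟦y, z · x⟧.
Proof. algebra_identity. Qed.

Lemma comm_deriv x y z : ⟦x · y, z⟧ = x · ⟦y, z⟧ + ⟦x, z⟧ · y.
Proof. algebra_identity. Qed.

Lemma comm_mul_swap x y z : ⟦x, y⟧ · z = x · ⟦y, z⟧ + ⟦x · z, y⟧.
Proof. algebra_identity. Qed.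

Lemma ad_square_mulr x y : ⟦x, ⟦x, y⟧⟧ · x = ⟦x, ⟦x, y · x⟧⟧.
Proof. algebra_identity. Qed.

(** Such x form an ideal, which is proper because AA is nonzero. *)
Lemma left_annihilator x : (forall a, x · a = 0) -> x = 0.
Proof.
move=> x0; have [[a [b ab]] /(_ (fun x => forall a, x · a = 0))[]] := simpleA.
- split.
  + by move=> c; rewrite linear0l.
  + by move=> y z y0 z0 c; rewrite linearDl y0 z0 addr0.
  + by move=> k y y0 c; rewrite linearZl_LR y0 scaler0.
  + by move=> y z z0 c; rewrite -mulA z0 linear0r.
  + by move=> y z z0 c; rewrite -mulA z0.
- exact.
- by move=> /(_ a b) ab0; rewrite ab0 eqxx in ab.
Qed.

Lemma right_annihilator x : (forall a, a · x = 0) -> x = 0.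
Proof.
move=> x0; have [[a [b ab]] /(_ (fun x => forall a, a · x = 0))[]] := simpleA.
- split.
  + by move=> c; rewrite linear0r.
  + by move=> y z y0 z0 c; rewrite linearDr y0 z0 addr0.
  + by move=> k y y0 c; rewrite linearZr_LR y0 scaler0.
  + by move=> y z z0 c; rewrite mulA z0.
  + by move=> y z z0 c; rewrite mulA z0 linear0l.
- exact.
- by move=> /(_ b a) ab0; rewrite ab0 eqxx in ab.
Qed.

Lemma simple_semiprime c : (forall a, c · a · c = 0) -> c = 0.
Proof.
move=> c0; have [_ /(_ (fun x => forall a, x · a · c = 0))[]] := simpleA.
- split.
  + by move=> a; rewrite !linear0l.
  + by move=> y z y0 z0 a; rewrite !linearDl y0 z0 addr0.
  + by move=> k y y0 a; rewrite !linearZl_LR y0 scaler0.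
  + by move=> y z z0 a; rewrite -!(mulA y) z0 linear0r.
  + by move=> y z z0 a; rewrite -(mulA z) z0.
- exact.
- move=> AAc; apply: right_annihilator => a.
  by apply: right_annihilator => b; rewrite mulA.
Qed.

Lemma central_annihilator z x :
  (forall a, ⟦z, a⟧ = 0) -> z != 0 -> z · x = 0 -> x = 0.
Proof.
move=> zC z0 zx; have [_ /(_ (fun x => z · x = 0))[]] := simpleA.
- split.
  + by rewrite linear0r.
  + by move=> a b a0 b0; rewrite linearDr a0 b0 addr0.
  + by move=> k a a0; rewrite linearZr_LR a0 scaler0.
  + by move=> a b b0; rewrite mulA (subr0_eq (zC a)) -mulA b0 linear0r.
  + by move=> a b b0; rewrite mulA b0 linear0l.
- exact.
- by move=> /left_annihilator /eqP; rewrite (negPf z0).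
Qed.

(** The Leibniz rule for the square of ad x gives 2[x,b][x,c] = 0. Hence [x,a]A[x,a] = 0, and
    semiprimeness applies. *)
Lemma ad_square0 x : (forall a, ⟦x, ⟦x, a⟧⟧ = 0) -> forall a, ⟦x, a⟧ = 0.
Proof.
move=> x2 a.
have xx0 b c : ⟦x, b⟧ · ⟦x, c⟧ = 0.
  apply: addvv_eq0.
  have -> : ⟦x, b⟧ · ⟦x, c⟧ + ⟦x, b⟧ · ⟦x, c⟧ =
      ⟦x, ⟦x, b · c⟧⟧ - ⟦x, ⟦x, b⟧⟧ · c - b · ⟦x, ⟦x, c⟧⟧ by algebra_identity.
  by rewrite !x2 linear0l linear0r !subr0.
apply: simple_semiprime => b.
have -> : ⟦x, a⟧ · b · ⟦x, a⟧ = ⟦x, a⟧ · ⟦x, b · a⟧ - ⟦x, a⟧ · ⟦x, b⟧ · a.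
  algebra_identity.
by rewrite !xx0 linear0l subr0.
Qed.

Lemma commutative_of_central_comm :
  (forall a b c, ⟦⟦a, b⟧, c⟧ = 0) -> forall a b, ⟦a, b⟧ = 0.
Proof.
move=> cC a b; apply: ad_square0 => c.
by rewrite comm_antisym cC oppr0.
Qed.

(** Let u = [a,b] and suppose z = [u,[u,c]] is nonzero. Both z and zu = [u,[u,cu]] are central, so
    z[u,e] = 0; then u is central and z = 0. *)
Lemma commutative_of_central_comm2 :
  (forall a b c d e, ⟦⟦⟦a, b⟧, ⟦c, d⟧⟧, e⟧ = 0) -> forall a b, ⟦a, b⟧ = 0.
Proof.
move=> ccC; apply: commutative_of_central_comm => a b.
apply: ad_square0 => c; apply: contrapT => /eqP z0.
have zC e : ⟦⟦⟦a, b⟧, ⟦⟦a, b⟧, c⟧⟧, e⟧ = 0 by exact: ccC.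
have uC e : ⟦⟦a, b⟧, e⟧ = 0.
  apply: (central_annihilator _ _ zC z0).
  by rewrite -[_ · _](addrK (⟦⟦⟦a, b⟧, ⟦⟦a, b⟧, c⟧⟧, e⟧ · ⟦a, b⟧)) -comm_deriv
    zC linear0l subr0 ad_square_mulr ccC.
by move: z0; rewrite uC eqxx.
Qed.

(** * Lie ideals *)

Definition lie_ideal (K : A -> Prop) : Prop :=
  [/\ K 0,
      forall x y, K x -> K y -> K (x + y),
      forall (c : F) x, K x -> K (c *: x)
    & forall x a, K x -> K ⟦x, a⟧].

(** This is the largest two-sided ideal inside [K]; left multiplication is handled by ax = xa -
    [x,a]. *)
Lemma lie_ideal_core K : lie_ideal K ->
  two_sided_ideal mul (fun x => K x /\ forall a, K (x · a)).
Proof.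
move=> [K0 KD KZ KL]; split.
- by split=> // a; rewrite linear0l.
- move=> x y [Kx KxA] [Ky KyA]; split; first exact: KD.
  by move=> a; rewrite linearDl; exact: KD.
- move=> c x [Kx KxA]; split; first exact: KZ.
  by move=> a; rewrite linearZl_LR; exact: KZ.
- have KN x : K x -> K (- x) by rewrite -scaleN1r; exact: KZ.
  move=> a x [Kx KxA]; split.
    have -> : a · x = x · a + - ⟦x, a⟧ by algebra_identity.
    by apply: KD => //; apply/KN/KL.
  move=> b; have -> : a · x · b = x · b · a + - ⟦x · b, a⟧ by algebra_identity.
  by apply: KD; [rewrite -mulA; exact: KxA | apply/KN/KL].
- by move=> a x [Kx KxA]; split=> // b; rewrite -mulA.
Qed.

(* Herstein's argument: T = {x | [x, A] <= K} is a subalgebra and a Lie ideal,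
   hence contains the ideal generated by [T, T]. *)
Lemma lie_ideal_dichotomy K : lie_ideal K ->
  (forall a b, K ⟦a, b⟧) \/ (forall x a, K x -> ⟦x, a⟧ = 0).
Proof.
move=> [K0 KD KZ KL]; pose T x := forall a, K ⟦x, a⟧.
have KN x : K x -> K (- x) by rewrite -scaleN1r; exact: KZ.
have TL : lie_ideal T.
  split.
  - by move=> a; rewrite comm0l.
  - by move=> x y Tx Ty a; rewrite commDl; exact: KD.
  - by move=> c x Tx a; rewrite commZl; exact: KZ.
  - by move=> x a Tx b; exact: KL.
have TM x y : T x -> T y -> T (x · y).
  by move=> Tx Ty a; rewrite comm_mull; exact: KD.
have [T0 TD TZ TLie] := TL.
have [coreT0|coreTA] := simpleA.2 _ (lie_ideal_core _ TL); last first.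
  by left=> a b; have [Ta _] := coreTA a; exact: Ta.
right=> x a Kx; have Tx : T x by move=> b; exact: KL.
(* [x,[x,a]] lies in the core of [T], since [x,[x,a]]b = [x,[x,a]b] - [x,a][x,b] has both terms in
   [T]. *)
apply: ad_square0 => {}a; apply: coreT0.
have TxTxa : T ⟦x, a⟧ by exact: TLie.
have TN y : T y -> T (- y) by rewrite -scaleN1r; exact: TZ.
split; first by rewrite comm_antisym; exact/TN/TLie.
move=> b; have -> : ⟦x, ⟦x, a⟧⟧ · b = ⟦x, ⟦x, a⟧ · b⟧ + - (⟦x, a⟧ · ⟦x, b⟧).
  algebra_identity.
by apply: TD; [exact: TLie | apply/TN/TM => //; exact: TLie].
Qed.

(** * Alternating Hochschild cocycles *)

Section AlternatingCocycle.
Variable psi : A -> A -> A -> F.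
Hypothesis psiP : forall c x x' y z,
  psi (c *: x + x') y z = c * psi x y z + psi x' y z.
Hypothesis psi_swap : forall x y z, psi y x z = - psi x y z.
Hypothesis psi_cycle : forall x y z, psi y z x = psi x y z.
(* psi is a Hochschild 3-cocycle; each term is rotated so that its product
   comes first. *)
Hypothesis psi_cocycle : forall x y z w,
  psi (x · y) z w - psi (y · z) w x + psi (z · w) x y - psi (w · x) y z = 0.

Let psiD x x' y z : psi (x + x') y z = psi x y z + psi x' y z.
Proof. by rewrite -[x]scale1r psiP mul1r scale1r. Qed.

Let psi0 y z : psi 0 y z = 0.
Proof. by apply: (addrI (psi 0 y z)); rewrite -psiD !addr0. Qed.

Let psiB x x' y z : psi (x - x') y z = psi x y z - psi x' y z.
Proof. by rewrite addrC -scaleN1r psiP mulN1r addrC. Qed.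

Let psi_swapr x y z : psi x z y = - psi x y z.
Proof. by rewrite psi_swap 2!psi_cycle. Qed.

Let pair_sum x y z w := psi ⟦x, y⟧ z w + psi ⟦z, w⟧ x y.

Let pair_sum_cycle x y z w : pair_sum x y z w = pair_sum y z w x.
Proof.
(* Adding the cocycle identity of the reversed quadruple turns products into commutators. *)
have E := psi_cocycle w z y x.
rewrite (psi_swapr _ x y) (psi_swapr _ w x) in E.
rewrite (psi_swapr _ z w) (psi_swapr _ y z) in E.
apply: subr0_eq; move: (congr2 +%R (psi_cocycle x y z w) E); rewrite addr0 => <-.
by rewrite /pair_sum !psiB; ring.
Qed.

Let pair_sum_swap x y z w : pair_sum y x z w = - pair_sum x y z w.
Proof. by rewrite /pair_sum (psi_swapr _ x y) !psiB; ring. Qed.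

Let pair_sum_swapr x y z w : pair_sum x y w z = - pair_sum x y z w.
Proof. by rewrite /pair_sum (psi_swapr _ z w) !psiB; ring. Qed.

(* pair_sum is invariant under cyclic shifts and odd in (x, y) and in (z, w);
   this makes it both even and odd in (y, z). *)
Lemma psi_comm_swap x y z w : psi ⟦x, y⟧ z w = - psi ⟦z, w⟧ x y.
Proof.
apply/eqP; rewrite -addr_eq0; apply/eqP; rewrite -/(pair_sum x y z w).
apply: (addvv_eq0 F^o).
have Eyz : pair_sum x z y w = - pair_sum x y z w.
  by rewrite pair_sum_cycle pair_sum_swap -pair_sum_cycle.
have := pair_sum_cycle y x z w.
rewrite pair_sum_swap (pair_sum_swapr x z y w) Eyz => /oppr_inj {1}->.
by rewrite addNr.
Qed.

Lemma psi_comm_shift a b c d e : psi ⟦⟦a, b⟧, c⟧ d e = - psi ⟦⟦d, e⟧, c⟧ a b.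
Proof.
by rewrite psi_comm_swap -psi_swap psi_comm_swap psi_swapr.
Qed.

Lemma psi_comm_iter a b c d e f :
  psi ⟦⟦⟦c, d⟧, e⟧, f⟧ a b = - psi ⟦⟦⟦a, b⟧, f⟧, e⟧ c d.
Proof.
by rewrite psi_comm_shift [psi ⟦_, f⟧ _ _]psi_swap opprK psi_comm_swap.
Qed.

(** Exchanging (a,b) with (c,d) preserves the value, by Jacobi and [psi_comm_iter]. It also negates
    it: by [psi_comm_swap] the value is -psi([a,b],[c,d],[e,f]). *)
Lemma psi_comm2_eq0 a b c d e f : psi ⟦⟦c, d⟧, ⟦e, f⟧⟧ a b = 0.
Proof.
have E : psi ⟦⟦c, d⟧, ⟦e, f⟧⟧ a b = psi ⟦⟦a, b⟧, ⟦e, f⟧⟧ c d.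
  rewrite !(comm_jacobi _ e f) 2!(psiB ⟦⟦_, e⟧, f⟧).
  by rewrite (psi_comm_iter a b c d e f) (psi_comm_iter a b c d f e) opprK addrC.
apply: (addvv_eq0 F^o).
rewrite {1}E psi_comm_swap [X in _ + X]psi_comm_swap.
by rewrite [psi ⟦a, b⟧ _ _]psi_swap opprK addNr.
Qed.

Let K u := forall y z, psi u y z = 0.

Let K_lie : lie_ideal K.
Proof.
split.
- exact: psi0.
- by move=> x x' Kx Kx' y z; rewrite psiD Kx Kx' addr0.
- by move=> c x Kx y z; rewrite -[c *: x]addr0 psiP Kx psi0 mulr0 addr0.
- by move=> x a Kx y z; rewrite psi_comm_swap psi_swap Kx !oppr0.
Qed.

(** Two terms of the cocycle identity have [u] as an argument and vanish; in the last, wu may become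
    uw because [u,w] is in [K]. *)
Let psi_mul_rotate u : K u ->
  forall t z w, psi (u · t) z w = psi (u · w) t z.
Proof.
move=> Ku t z w; apply/eqP; rewrite -subr_eq0 -(psi_cocycle u t z w); apply/eqP.
rewrite (psi_cycle u (t · z) w) Ku (psi_swap u (z · w)) Ku subr0 oppr0 addr0.
have [_ _ _ KL] := K_lie; have : psi ⟦u, w⟧ t z = 0 by exact: KL.
by rewrite psiB => /subr0_eq->.
Qed.

Lemma alternating_cocycle_eq0 :
  (exists a b, ⟦a, b⟧ != 0) -> forall x y z, psi x y z = 0.
Proof.
move=> [a0 [b0 ab0]]; have Ncomm : ~ forall a b, ⟦a, b⟧ = 0.
  by move=> comm0; rewrite comm0 eqxx in ab0.
have [Kcomm|Kcentral] := lie_ideal_dichotomy _ K_lie; last first.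
  case: Ncomm; apply: commutative_of_central_comm2 => a b c d e.
  by apply: Kcentral => y z; exact: psi_comm2_eq0.
have [core0|coreA] := simpleA.2 _ (lie_ideal_core _ K_lie); last first.
  by move=> x; have [] := coreA x.
case: Ncomm; apply: commutative_of_central_comm => a b c; apply: core0.
split; first exact: Kcomm.
(* What remains is psi([a,b][c,t],y,z); rotation makes [c,t] a separate argument, where [Kcomm]
   kills it. *)
move=> t y z; rewrite comm_mul_swap psiD (Kcomm _ _ y z) addr0.
by rewrite (psi_mul_rotate _ (Kcomm a b)) psi_swap Kcomm oppr0.
Qed.

End AlternatingCocycle.

(** * Scalar forms vanishing on commuting pairs *)

Section ScalarForm.
Variable Phi : {biscalar A}.
Hypothesis Phi_comm0 : forall x y, ⟦x, y⟧ = 0 -> Phi x y = 0.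

Let Phi_alt x : Phi x x = 0.
Proof. by apply: Phi_comm0; rewrite /commutator subrr. Qed.

Let Phi_skew x y : Phi x y = - Phi y x.
Proof.
apply/eqP; rewrite -addr_eq0; apply/eqP.
by have := Phi_alt (x + y); rewrite linearDl !linearDr !Phi_alt addr0 add0r.
Qed.

Let psi x y z := Phi (x · y) z + Phi (y · z) x + Phi (z · x) y.

Let psi_swap x y z : psi y x z = - psi x y z.
Proof.
pose q u := Phi (u · u) u.
have q0 u : q u = 0 by apply: Phi_comm0; rewrite /commutator mulA subrr.
apply/eqP; rewrite -addr_eq0; apply/eqP.
(* the component of q (x + y + z) that is linear in x, y and z *)
have -> : psi y x z + psi x y z =
    q (x + y + z) - q (x + y) - q (y + z) - q (x + z) + q x + q y + q z.
  by rewrite /psi /q !(linearDl, linearDr); ring.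
by rewrite !q0 !subr0 !addr0.
Qed.

Lemma scalar_form_cocycle : cocycle2 mul Phi.
Proof.
split=> // x y z.
have [[a [b ab]]|comm0] := pselect (exists a b, ⟦a, b⟧ != 0); last first.
  have comm0' a b : ⟦a, b⟧ = 0.
    by apply: contrapT => /eqP ab; apply: comm0; exists a, b.
  by rewrite !comm0' !linear0l !addr0.
have psi0 : forall x y z, psi x y z = 0.
  apply: alternating_cocycle_eq0; last by exists a, b.
  - by move=> c u v y' z'; rewrite /psi !(linearPl, linearPr) /=; ring.
  - exact: psi_swap.
  - by move=> u v w; rewrite /psi; ring.
  - move=> u v w t; rewrite /psi !mulA.
    (* Terms with a triple product cancel in pairs; those pairing two products cancel by
       skew-symmetry. *)
    by rewrite (Phi_skew (w · t)) (Phi_skew (t · u) (v · w)); ring.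
have -> : Phi ⟦x, y⟧ z + Phi ⟦z, x⟧ y + Phi ⟦y, z⟧ x = psi x y z - psi y x z.
  by rewrite /psi !linearBl; ring.
by rewrite !psi0 subrr.
Qed.

End ScalarForm.
End SimpleAlgebra.

(** * From scalar forms to vector-valued maps *)

Theorem corollary2p7 (F : fieldType) (A : lmodType F)
    (mul : {bilinear A -> A -> A}) (mulA : associative mul)
    (charF : 2%N \notin [pchar F]) (simpleA : simple_algebra mul)
    (H2A : trivial_H2 mul) :
  zLpd mul.
Proof.
move=> X Phi Phi0.
pose primitive (f : {scalar X}) (tau : {scalar A}) :=
  forall x y, f (Phi x y) = tau (commutator mul x y).
have primitiveP f : exists tau, primitive f tau.
  pose fPhi x y := f (Phi x y).
  have fPhi_bilinear : bilinear_for *%R *%R fPhi.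
    by split=> u c v w; rewrite /fPhi ?linearPl ?linearPr linearP.
  pose fPhiM := bilinear_isBilinear.Build F A A F *%R *%R fPhi fPhi_bilinear.
  pose fPhiB : {biscalar A} := HB.pack fPhi fPhiM.
  apply: (H2A fPhiB); apply: scalar_form_cocycle => // x y xy0.
  by rewrite /= /fPhi Phi0 // linear0.
(* The linear span of the pairs ([x, y], Phi x y), described by the functionals
   that vanish on it. *)
pose G := [set p : A * X | forall f tau, primitive f tau -> f p.2 = tau p.1].
have [|tau tauP] := @linear_graph_total F A X G.
  split; first split.
  - by move=> f tau _; rewrite !linear0.
  - move=> c p q Gp Gq f tau ftau.
    by rewrite /= !linearP /= (Gp _ _ ftau) (Gq _ _ ftau).
  (* Single-valuedness: every [f] has a primitive [tau], so f w = tau 0 = 0. *)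
  move=> w Gw; apply: scalar_separation => f.
  by have [tau ftau] := primitiveP f; rewrite (Gw _ _ ftau) linear0.
by exists tau => x y; apply: tauP => f sigma; exact.
Qed.
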